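(* Let $\mathcal{G}$ be a groupoid whose set $\mathcal{G}_0$ of identities is finite, let $\Bbbk\mathcal{G}$ be its groupoid algebra over a field $\Bbbk$, and let $C$ be a coalgebra over $\Bbbk$. The following statements are equivalent: (i) There exists a partial action $\theta=(\{\theta_g\},\{C_g\})_{g\in\mathcal{G}}$ of $\mathcal{G}$ on $C$ such that $C=\bigoplus_{e\in\mathcal{G}_0}C_e$. (ii) $C$ is a symmetric (left) partial $\Bbbk\mathcal{G}$-module coalgebra, i.e. there exists a linear map $\cdot:\Bbbk\mathcal{G}\otimes C\to C$ making $C$ a symmetric left partial $\Bbbk\mathcal{G}$-module coalgebra.
   Context: Everything is over a fixed field $\Bbbk$, $\otimes=\otimes_\Bbbk$, and Sweedler notation $\Delta(c)=c_1\otimes c_2$ (summation implied) is used; $\varepsilon$ is the counit. Groupoid: a nonempty set $\mathcal{G}$ with a partially defined associative product in which every $g$ has an inverse $g^{-1}$, with $d(g)=g^{-1}g$ and $r(g)=gg^{-1}$; $gh$ is defined iff $d(g)=r(h)$. $\mathcal{G}_0=\{d(g):g\in\mathcal{G}\}$ is the set of identities and $\mathcal{G}^2=\{(g,h): gh\text{ is defined}\}$. Groupoid algebra: $\Bbbk\mathcal{G}$ has basis $\{\delta_g\}_{g\in\mathcal{G}}$, product $\delta_g\delta_h=\delta_{gh}$ if $gh$ is defined and $0$ otherwise, unit $\sum_{e\in\mathcal{G}_0}\delta_e$, $\Delta(\delta_g)=\delta_g\otimes\delta_g$, $\varepsilon(\delta_g)=1$, $S(\delta_g)=\delta_{g^{-1}}$.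 It is a weak Hopf algebra. Left partial $H$-module coalgebra (for a weak Hopf algebra $H$): a coalgebra $C$ with a linear map $\cdot:H\otimes C\to C$ such that for all $h,k\in H$, $c\in C$: (PMC1) $1_H\cdot c=c$; (PMC2) $\Delta(h\cdot c)=h_1\cdot c_1\otimes h_2\cdot c_2$; (PMC3) $h\cdot(k\cdot c)=(hk_1\cdot c_1)\,\varepsilon(k_2\cdot c_2)$. It is symmetric if moreover $h\cdot(k\cdot c)=\varepsilon(k_1\cdot c_1)\,(hk_2\cdot c_2)$. Partial action of a groupoid $\mathcal{G}$ on a coalgebra $C$: a family of subcoalgebras $\{C_g\}_{g\in\mathcal{G}}$ of $C$ and coalgebra isomorphisms $\{\theta_g:C_{g^{-1}}\to C_g\}_{g\in\mathcal{G}}$ such that: (i) for each $g\in\mathcal{G}$ there is a linear projection $P_g:C\to C$ with $P_g(C)=C_g$ and, for all $c\in C$, $(P_g\otimes P_g)\Delta(c)=\Delta(P_g(c))$ and $P_g(c)=P_{r(g)}(c_1)\varepsilon(P_g(c_2))=P_{r(g)}(c_2)\varepsilon(P_g(c_1))$; (ii) $\theta_e=I_{C_e}$ (identity map) for each $e\in\mathcal{G}_0$; (iii) $P_g\circ P_h=P_h\circ P_g$ for all $g,h\in\mathcal{G}$; and for all $(g,h)\in\mathcal{G}^2$, $\theta_{h^{-1}}\circ P_h\circ P_{g^{-1}}=P_{(gh)^{-1}}\circ\theta_{h^{-1}}\circ P_h$ and $\theta_g\circ\theta_h\circ P_{(gh)^{-1}}\circ P_{h^{-1}}=\theta_{gh}\circ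 P_{(gh)^{-1}}\circ P_{h^{-1}}$. *)

(* Defs.v *)
From HB Require Import structures.
From mathcomp Require Import all_boot all_order all_algebra.
From mathcomp Require Import boolp classical_sets functions cardinality fsbigop.
From mathcomp Require Import finmap monalg.

Set Implicit Arguments.
Unset Strict Implicit.
Unset Printing Implicit Defensive.

Import GRing.Theory.
Local Open Scope ring_scope.
Local Open Scope quotient_scope.

Reserved Notation "V ⊗ W" (at level 40, left associativity).
Reserved Notation "\sweedler_ ( x , y <- c ) E"
  (at level 36, E at level 36, x name, y name, c at level 90,
   format "'[' \sweedler_ ( x ,  y  <-  c ) '/  '  E ']'").

(* {malg k[K]} is the vector space with basis the choiceType K, <<x>> being the
   basis vector of x. *)
HB.lock Definition mext {k : fieldType} {K : choiceType} {U : lmodType k}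
  (f : K -> U) (u : {malg k[K]}) : U := \sum_(x <- msupp u) u@_x *: f x.

Section LinearExtension.
Context {k : fieldType} {K : choiceType} {U : lmodType k}.
Implicit Types (f : K -> U) (u : {malg k[K]}).

Lemma mextEw f u (D : {fset K}) : (msupp u `<=` D)%fset ->
  mext f u = \sum_(x <- D) u@_x *: f x.
Proof.
move=> sub; rewrite mext.unlock; apply: big_fset_incl => // x _ /mcoeff_outdom ->.
by rewrite scale0r.
Qed.

Fact mext_is_linear f : linear (mext f).
Proof.
move=> a u v; set D := (msupp u `|` msupp v)%fset.
rewrite (@mextEw f u D) ?fsubsetUl // (@mextEw f v D) ?fsubsetUr //.
rewrite (@mextEw f (a *: u + v) D); last first.
  apply: fsubset_trans (msuppD_le _ _) _.
  by apply: fsetSU; apply: msuppZ_le.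
rewrite scaler_sumr -big_split /=; apply: eq_bigr => x _.
by rewrite mcoeffD mcoeffZ scalerDl scalerA.
Qed.

HB.instance Definition _ f :=
  GRing.isLinear.Build k {malg k[K]} U *:%R (mext f) (mext_is_linear f).

Lemma mextU f x : mext f << x >> = f x.
Proof.
rewrite (@mextEw f _ [fset x]%fset) ?msuppU_le //.
by rewrite big_seq_fset1 mcoeffUU scale1r.
Qed.

Lemma malg_span u : u = \sum_(x <- msupp u) u@_x *: << x >>.
Proof.
rewrite [LHS]monalgE; apply: eq_bigr => x _; apply/malgP => y.
by rewrite mcoeffZ !mcoeffU; case: eqP; rewrite ?mulr1 ?mulr0.
Qed.

Lemma malg_ext (f g : {malg k[K]} -> U) : linear f -> linear g ->
  (forall x, f << x >> = g << x >>) -> f =1 g.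
Proof.
move=> lf lg fg u.
pose F : {linear {malg k[K]} -> U} := HB.pack f (GRing.isLinear.Build _ _ _ _ f lf).
pose H : {linear {malg k[K]} -> U} := HB.pack g (GRing.isLinear.Build _ _ _ _ g lg).
rewrite -[f]/(F : _ -> _) -[g]/(H : _ -> _) (malg_span u) !linear_sum.
by apply: eq_bigr => x _; rewrite !linearZ /= fg.
Qed.

End LinearExtension.

(* The tensor product: the free vector space on V * W modulo the subspace
   spanned by the bilinearity relators. *)
Section Tensor.
Context {k : fieldType} (V W : lmodType k).

Inductive tensor_rel : {malg k[(V * W)%type]} -> Prop :=
| TensorDl x x' y :
    tensor_rel (<< (x + x', y) >> - << (x, y) >> - << (x', y) >>)
| TensorDr x y y' :
    tensor_rel (<< (x, y + y') >> - << (x, y) >> - << (x, y') >>)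
| TensorZl a x y : tensor_rel (<< (a *: x, y) >> - a *: << (x, y) >>)
| TensorZr a x y : tensor_rel (<< (x, a *: y) >> - a *: << (x, y) >>)
| Tensor0 : tensor_rel 0
| TensorL a u v : tensor_rel u -> tensor_rel v -> tensor_rel (a *: u + v).

Definition tensor_relb : {pred {malg k[(V * W)%type]}} := fun u => `[< tensor_rel u >].

Fact tensor_relb_closed : zmod_closed tensor_relb.
Proof.
split=> [|u v /asboolP ru /asboolP rv]; apply/asboolP; first exact: Tensor0.
by rewrite -[- v]scaleN1r addrC; apply: TensorL.
Qed.

HB.instance Definition _ :=
  GRing.isZmodClosed.Build _ tensor_relb tensor_relb_closed.

Definition tensor_relations : zmodClosed {malg k[(V * W)%type]} := tensor_relb.

Definition tensor : Type := Quotient.quot tensor_relations.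

HB.instance Definition _ := GRing.Zmodule.on tensor.

Definition tensor_pi (u : {malg k[(V * W)%type]}) : tensor :=
  \pi_(Quotient.quot tensor_relations) u.
Definition tensor_repr (t : tensor) : {malg k[(V * W)%type]} :=
  repr (t : Quotient.quot tensor_relations).

Lemma tensor_reprK t : tensor_pi (tensor_repr t) = t.
Proof. exact: reprK. Qed.

Lemma tensor_piP u v : tensor_pi u = tensor_pi v <-> tensor_rel (u - v).
Proof.
rewrite /tensor_pi; split=> [/eqP|r].
  by rewrite -Quotient.idealrBE => /asboolP.
by apply/eqP; rewrite -Quotient.idealrBE; apply/asboolP.
Qed.

Lemma tensor_piD u v : tensor_pi (u + v) = tensor_pi u + tensor_pi v.
Proof.
by rewrite /tensor_pi; apply: (@pi_addr _ _ _ _ _ (Quotient.quot tensor_relations)).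
Qed.

Definition tensor_scale (a : k) (t : tensor) : tensor :=
  tensor_pi (a *: tensor_repr t).

Lemma tensor_piZ a u : tensor_pi (a *: u) = tensor_scale a (tensor_pi u).
Proof.
apply/tensor_piP; rewrite -scalerBr -[X in tensor_rel X]addr0.
by apply: TensorL; [apply/tensor_piP; rewrite tensor_reprK | apply: Tensor0].
Qed.

Fact tensor_scaleA a b t :
  tensor_scale a (tensor_scale b t) = tensor_scale (a * b) t.
Proof. by rewrite -[t]tensor_reprK -!tensor_piZ scalerA. Qed.

Fact tensor_scale1 : left_id 1 tensor_scale.
Proof. by move=> t; rewrite -[t]tensor_reprK -tensor_piZ scale1r. Qed.

Fact tensor_scaleDr : right_distributive tensor_scale +%R.
Proof.
move=> a t s; rewrite -[t]tensor_reprK -[s]tensor_reprK -tensor_piD.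
by rewrite -!tensor_piZ scalerDr tensor_piD.
Qed.

Fact tensor_scaleDl t : {morph tensor_scale^~ t : a b / a + b}.
Proof.
by move=> a b; rewrite -[t]tensor_reprK -!tensor_piZ scalerDl tensor_piD.
Qed.

HB.instance Definition _ := GRing.Zmodule_isLmodule.Build k tensor
  tensor_scaleA tensor_scale1 tensor_scaleDr tensor_scaleDl.

Fact tensor_pi_is_linear : linear tensor_pi.
Proof. by move=> a u v; rewrite tensor_piD tensor_piZ. Qed.

HB.instance Definition _ :=
  GRing.isLinear.Build k _ tensor *:%R tensor_pi tensor_pi_is_linear.

End Tensor.

HB.lock Definition tens {k : fieldType} {V W : lmodType k} (x : V) (y : W) :
  tensor V W := tensor_pi << (x, y) >>.

(* The linear map V ⊗ W -> U induced by f. It is meaningful only for a bilinear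
   f; otherwise its value depends on the chosen representatives. *)
HB.lock Definition tlift {k : fieldType} {V W U : lmodType k} (f : V -> W -> U)
  (t : tensor V W) : U := mext (fun p => f p.1 p.2) (tensor_repr t).

Section TensorTheory.
Context {k : fieldType} {V W : lmodType k}.
Local Notation tensor := (tensor V W).

Fact tens_linear_l (y : W) : linear (fun x : V => tens x y).
Proof.
move=> a x x' /=; rewrite tens.unlock -[RHS]/(_ + _) -linearZ -linearD /=.
apply/tensor_piP.
have := TensorL 1 (TensorDl (a *: x) x' y) (TensorZl a x y).
by rewrite scale1r; congr tensor_rel; rewrite opprD addrAC !addrA subrK addrAC.
Qed.

Fact tens_linear_r (x : V) : linear (fun y : W => tens x y).
Proof.
move=> a y y' /=; rewrite tens.unlock -[RHS]/(_ + _) -linearZ -linearD /=.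
apply/tensor_piP.
have := TensorL 1 (TensorDr x (a *: y) y') (TensorZr a x y).
by rewrite scale1r; congr tensor_rel; rewrite opprD addrAC !addrA subrK addrAC.
Qed.

Lemma tensor_ind_sum (t : tensor) : exists (s : seq (k * (V * W))),
  t = \sum_(p <- s) p.1 *: tens p.2.1 p.2.2.
Proof.
exists [seq ((tensor_repr t)@_x, x) | x <- msupp (tensor_repr t)].
rewrite big_map -[LHS]tensor_reprK {1}[tensor_repr t]malg_span linear_sum.
by apply: eq_bigr => -[x y] _; rewrite linearZ tens.unlock.
Qed.

Section Lift.
Context {U : lmodType k} (f : V -> W -> U).
Hypotheses (fl : forall y, linear (f^~ y)) (fr : forall x, linear (f x)).

Lemma tlift_pi u : tlift f (tensor_pi u) = mext (fun p => f p.1 p.2) u.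
Proof.
apply/eqP; rewrite tlift.unlock -subr_eq0 -linearB /=; apply/eqP.
have: tensor_rel (tensor_repr (tensor_pi u) - u).
  by apply/tensor_piP; rewrite tensor_reprK.
have fD x x' y : f (x + x') y = f x y + f x' y.
  by have := fl y 1 x x'; rewrite !scale1r.
have fD' x y y' : f x (y + y') = f x y + f x y'.
  by have := fr x 1 y y'; rewrite !scale1r.
have f0 y : f 0 y = 0.
  by have /= := fl y (-1) 0 0; rewrite scaler0 addr0 scaleN1r addNr.
have f0' x : f x 0 = 0.
  by have /= := fr x (-1) 0 0; rewrite scaler0 addr0 scaleN1r addNr.
have fZ a x y : f (a *: x) y = a *: f x y.
  by have /= := fl y a x 0; rewrite f0 !addr0.
have fZ' a x y : f x (a *: y) = a *: f x y.
  by have /= := fr x a y 0; rewrite f0' !addr0.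
move: (_ - u) => w; elim=> {w} [x x' y|x y y'|a x y|a x y||a w v _ hw _ hv].
- by rewrite !linearB /= !mextU /= fD addrAC addrK subrr.
- by rewrite !linearB /= !mextU /= fD' addrAC addrK subrr.
- by rewrite linearB linearZ /= !mextU /= fZ subrr.
- by rewrite linearB linearZ /= !mextU /= fZ' subrr.
- by rewrite linear0.
- by rewrite linearP /= hw hv scaler0 addr0.
Qed.

Lemma tliftE x y : tlift f (tens x y) = f x y.
Proof. by rewrite tens.unlock tlift_pi mextU. Qed.

Lemma tlift_linear : linear (tlift f).
Proof.
move=> a t s; rewrite -[t]tensor_reprK -[s]tensor_reprK -linearP.
by rewrite !tlift_pi linearP.
Qed.

End Lift.

Lemma tensor_ext {U : lmodType k} (f g : tensor -> U) : linear f -> linear g ->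
  (forall x y, f (tens x y) = g (tens x y)) -> f =1 g.
Proof.
move=> lf lg fg t; case: (tensor_ind_sum t) => s ->.
pose F : {linear tensor -> U} := HB.pack f (GRing.isLinear.Build _ _ _ _ f lf).
pose H : {linear tensor -> U} := HB.pack g (GRing.isLinear.Build _ _ _ _ g lg).
rewrite -[f]/(F : _ -> _) -[g]/(H : _ -> _) !linear_sum.
by apply: eq_bigr => p _; rewrite !linearZ /= fg.
Qed.

End TensorTheory.

Arguments tensor {k} (V W)%_type_scope.
Notation "V ⊗ W" := (tensor V W) : type_scope.
Notation "x ⊗ y" := (tens x y) : ring_scope.

Section TensorMap.
Context {k : fieldType}.

Definition tmap {V W V' W' : lmodType k} (f : V -> V') (g : W -> W') :
  V ⊗ W -> V' ⊗ W' := tlift (fun x y => f x ⊗ g y).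

Definition tassoc {U V W : lmodType k} : U ⊗ (V ⊗ W) -> (U ⊗ V) ⊗ W :=
  tlift (fun u => tlift (fun v w => (u ⊗ v) ⊗ w)).

Lemma tlift_linear_fun {V W U X : lmodType k} (F : X -> V -> W -> U) t :
  (forall x y, linear (fun a => F a x y)) -> linear (fun a => tlift (F a) t).
Proof.
move=> lF a x y; rewrite tlift.unlock mext.unlock scaler_sumr -big_split /=.
by apply: eq_bigr => p _; rewrite lF scalerDr !scalerA mulrC.
Qed.

Section TensorMapTheory.
Context {V W V' W' : lmodType k} (f : V -> V') (g : W -> W').
Hypotheses (lf : linear f) (lg : linear g).

Let tmap_l y : linear (fun x => f x ⊗ g y).
Proof. by move=> a u v /=; rewrite lf tens_linear_l. Qed.

Let tmap_r x : linear (fun y => f x ⊗ g y).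
Proof. by move=> a u v /=; rewrite lg tens_linear_r. Qed.

Lemma tmap_linear : linear (tmap f g). Proof. exact: tlift_linear. Qed.

Lemma tmapE x y : tmap f g (x ⊗ y) = f x ⊗ g y. Proof. exact: tliftE. Qed.

End TensorMapTheory.

Section TensorAssocTheory.
Context {U V W : lmodType k}.

Let tassoc_l u w : linear (fun v : V => u ⊗ v ⊗ w : (U ⊗ V) ⊗ W).
Proof. by move=> a x y /=; rewrite tens_linear_r tens_linear_l. Qed.

Let tassoc_r u v : linear (fun w : W => u ⊗ v ⊗ w : (U ⊗ V) ⊗ W).
Proof. by move=> a x y /=; rewrite tens_linear_r. Qed.

Let tassoc_fun (t : V ⊗ W) :
  linear (fun u : U => tlift (fun v w => u ⊗ v ⊗ w : (U ⊗ V) ⊗ W) t).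
Proof.
by apply: tlift_linear_fun => v w a x y; rewrite !tens_linear_l.
Qed.

Lemma tassoc_linear : linear (@tassoc U V W).
Proof.
apply: tlift_linear => [t|u]; first exact: tassoc_fun.
by apply: tlift_linear; [apply: tassoc_l | apply: tassoc_r].
Qed.

Lemma tassocE u v w : @tassoc U V W (u ⊗ (v ⊗ w)) = u ⊗ v ⊗ w.
Proof.
have lr x : linear (tlift (fun v w => x ⊗ v ⊗ w : (U ⊗ V) ⊗ W)).
  by apply: tlift_linear; [apply: tassoc_l | apply: tassoc_r].
by rewrite /tassoc (tliftE tassoc_fun lr) (tliftE (tassoc_l u) (tassoc_r u)).
Qed.

End TensorAssocTheory.

End TensorMap.

HB.mixin Record Lmodule_isCoalgebra (k : fieldType) C of GRing.Lmodule k C := {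
  comul : {linear C -> (C ⊗ C)%type};
  counit : {scalar C};
  comulA : forall c, tassoc (tmap idfun comul (comul c)) =
                     tmap comul idfun (comul c);
  counitl : forall c, tlift (fun c1 c2 => counit c1 *: c2) (comul c) = c;
  counitr : forall c, tlift (fun c1 c2 => counit c2 *: c1) (comul c) = c
}.

#[short(type="coalgType")]
HB.structure Definition Coalgebra (k : fieldType) :=
  { C of GRing.Lmodule k C & Lmodule_isCoalgebra k C }.

(* E must be linear in each of the bound variables x and y. *)
Notation "\sweedler_ ( x , y <- c ) E" :=
  (tlift (fun x y => E) (comul c)) : ring_scope.

(* Weak Hopf algebras in the sense of Bohm, Nill and Szlachanyi. *)
HB.mixin Record isWeakHopfAlgebra (k : fieldType) H
    of GRing.Algebra k H & Coalgebra k H := {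
  comulM : forall x y : H, comul (x * y) =
    \sweedler_(x1, x2 <- x) \sweedler_(y1, y2 <- y) ((x1 * y1) ⊗ (x2 * y2));
  counitMl : forall x y z : H, counit (x * y * z) =
    \sweedler_(y1, y2 <- y) (counit (x * y1) * counit (y2 * z) : k^o);
  counitMr : forall x y z : H, counit (x * y * z) =
    \sweedler_(y1, y2 <- y) (counit (x * y2) * counit (y1 * z) : k^o);
  comul1l : tmap comul idfun (comul (1 : H)) =
    \sweedler_(a, b <- (1 : H)) \sweedler_(c, d <- (1 : H)) ((a ⊗ (b * c)) ⊗ d);
  comul1r : tmap comul idfun (comul (1 : H)) =
    \sweedler_(a, b <- (1 : H)) \sweedler_(c, d <- (1 : H)) ((a ⊗ (c * b)) ⊗ d);
  antipode : {linear H -> H};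
  antipodel : forall h : H, \sweedler_(h1, h2 <- h) (h1 * antipode h2) =
    \sweedler_(a, b <- (1 : H)) (counit (a * h) *: b);
  antipoder : forall h : H, \sweedler_(h1, h2 <- h) (antipode h1 * h2) =
    \sweedler_(a, b <- (1 : H)) (counit (h * b) *: a);
  antipodeM : forall h : H, \sweedler_(h1, h' <- h) \sweedler_(h2, h3 <- h')
    (antipode h1 * h2 * antipode h3) = antipode h
}.

#[short(type="weakHopfAlgType")]
HB.structure Definition WeakHopfAlgebra (k : fieldType) :=
  { H of GRing.Algebra k H & Coalgebra k H & isWeakHopfAlgebra k H }.

(* gmul g h is Some (g h) when the product is defined and None otherwise; the
   associativity axiom says that (f g) h is defined iff f (g h) is, and that they
   then agree. *)
HB.mixin Record Choice_isGroupoid G of Choice G := {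
  gmul : G -> G -> option G;
  ginv : G -> G;
  gdom : G -> G;
  gran : G -> G;
  groupoid_nonempty : exists g : G, True;
  gmulA : forall f g h, obind (gmul f) (gmul g h) = obind (gmul^~ h) (gmul f g);
  gmulVg : forall g, gmul (ginv g) g = Some (gdom g);
  gmulgV : forall g, gmul g (ginv g) = Some (gran g);
  gmul_dom : forall g, gmul g (gdom g) = Some g;
  gmul_ran : forall g, gmul (gran g) g = Some g;
  gmul_defined : forall g h, isSome (gmul g h) <-> gdom g = gran h
}.

#[short(type="groupoidType")]
HB.structure Definition Groupoid := { G of Choice G & Choice_isGroupoid G }.

Definition identities (G : groupoidType) : set G := range (@gdom G).
Arguments identities : clear implicits.

Section GroupoidTheory.
Context {G : groupoidType}.
Implicit Types g h e : G.

Lemma gdom_gran g : gdom (gran g) = gran g.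
Proof. by apply/gmul_defined; rewrite gmul_ran. Qed.

Lemma gran_gdom g : gran (gdom g) = gdom g.
Proof. by apply/esym/gmul_defined; rewrite gmul_dom. Qed.

Lemma identities_gdom g : identities G (gdom g).
Proof. by exists g. Qed.

Lemma identities_gran g : identities G (gran g).
Proof. by exists (gran g); rewrite // gdom_gran. Qed.

Lemma identity_gran e : identities G e -> gran e = e.
Proof. by case=> g _ <-; apply: gran_gdom. Qed.

Lemma identity_gdom e : identities G e -> gdom e = e.
Proof. by move=> /identity_gran re; rewrite -{1}re gdom_gran. Qed.

Lemma gmul_idl e g : identities G e ->
  gmul e g = if e == gran g then Some g else None.
Proof.
move=> ide; case: eqP => [->|ne]; first exact: gmul_ran.
case E: (gmul e g) => [x|//]; case: ne; rewrite -{1}(identity_gdom ide).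
by apply/gmul_defined; rewrite E.
Qed.

Lemma gmul_idr e g : identities G e ->
  gmul g e = if e == gdom g then Some g else None.
Proof.
move=> ide; case: eqP => [->|ne]; first exact: gmul_dom.
case E: (gmul g e) => [x|//]; case: ne; rewrite -{1}(identity_gran ide).
by apply/esym/gmul_defined; rewrite E.
Qed.

End GroupoidTheory.

(* The identities are finite in number, so that the algebra has a unit. *)
Definition groupoid_algebra (k : fieldType) (G : groupoidType)
  (fG : finite_set (identities G)) : Type := {malg k[G]}.

Section GroupoidAlgebra.
Context (k : fieldType) (G : groupoidType) (fG : finite_set (identities G)).
Local Notation kG := (groupoid_algebra k fG).

HB.instance Definition _ := GRing.Lmodule.on kG.

Definition delta (g : G) : kG := << g >>.

Definition delta_opt (o : option G) : kG := if o is Some g then delta g else 0.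

Definition galg_mul (u v : kG) : kG :=
  mext (fun g => mext (fun h => delta_opt (gmul g h)) v) u.

Definition galg_one : kG := \sum_(e \in identities G) delta e.

Lemma linear_at0 {U V : lmodType k} (f : U -> V) : linear f -> f 0 = 0.
Proof. by move=> lf; have /= := lf (-1) 0 0; rewrite scaler0 addr0 scaleN1r addNr. Qed.

Lemma linear_atZ {U V : lmodType k} (f : U -> V) a u :
  linear f -> f (a *: u) = a *: f u.
Proof. by move=> lf; have /= := lf a u 0; rewrite (linear_at0 lf) !addr0. Qed.

Lemma mext_linear_r {K : choiceType} {U V : lmodType k} (F : K -> V -> U) u :
  (forall x, linear (F x)) -> linear (fun v => mext (F^~ v) u).
Proof.
move=> lF a v w; rewrite mext.unlock scaler_sumr -big_split /=.
by apply: eq_bigr => x _; rewrite lF scalerDr !scalerA mulrC.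
Qed.

Lemma galg_mul_linear_l v : linear (galg_mul^~ v).
Proof. exact: mext_is_linear. Qed.

Lemma galg_mul_linear_r u : linear (galg_mul u).
Proof. by apply: mext_linear_r => g; apply: mext_is_linear. Qed.

Lemma galg_mulE g h : galg_mul (delta g) (delta h) = delta_opt (gmul g h).
Proof. by rewrite /galg_mul !mextU. Qed.

Lemma galg_mul_optE o h :
  galg_mul (delta_opt o) (delta h) = delta_opt (obind (gmul^~ h) o).
Proof.
case: o => [g|]; first exact: galg_mulE.
exact: linear_at0 (galg_mul_linear_l _).
Qed.

Lemma galg_mul_optEr o h :
  galg_mul (delta h) (delta_opt o) = delta_opt (obind (gmul h) o).
Proof.
case: o => [g|]; first exact: galg_mulE.
exact: linear_at0 (galg_mul_linear_r _).
Qed.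

Lemma galg_ext {U : lmodType k} (f g : kG -> U) : linear f -> linear g ->
  (forall x, f (delta x) = g (delta x)) -> f =1 g.
Proof. exact: malg_ext. Qed.

Fact galg_mulA : associative galg_mul.
Proof.
have lm := galg_mul_linear_l; have rm := galg_mul_linear_r.
move=> u v w; move: u; apply: galg_ext.
- exact: lm.
- by move=> a u u' /=; rewrite !lm.
move=> f; move: v; apply: galg_ext.
- by move=> a v v' /=; rewrite lm rm.
- by move=> a v v' /=; rewrite rm lm.
move=> g; move: w; apply: galg_ext.
- by move=> a v v' /=; rewrite !rm.
- exact: rm.
by move=> h; rewrite !galg_mulE galg_mul_optE galg_mul_optEr gmulA.
Qed.

Lemma galg_oneE : galg_one = \sum_(e <- fset_set (identities G)) delta e.
Proof. by rewrite /galg_one fsbig_finite. Qed.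

Lemma sum_identities (U : lmodType k) (F : G -> U) e0 : identities G e0 ->
  \sum_(e <- fset_set (identities G)) (if e == e0 then F e else 0) = F e0.
Proof.
move=> ie; have e0in : e0 \in fset_set (identities G) by rewrite in_fset_set // mem_set.
rewrite (bigD1_seq e0) ?fset_uniq //= eqxx big1 ?addr0 // => e.
by case: (e == e0).
Qed.

Fact galg_mul1l : left_id galg_one galg_mul.
Proof.
apply: galg_ext => [|a u v //|h]; first exact: galg_mul_linear_r.
pose F : {linear kG -> kG} := HB.pack (galg_mul^~ (delta h))
  (GRing.isLinear.Build _ _ _ _ (galg_mul^~ (delta h)) (galg_mul_linear_l _)).
rewrite -[LHS]/(F galg_one) galg_oneE linear_sum.
rewrite (eq_big_seq (fun e => if e == gran h then delta h else 0)) => [|e].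
  by rewrite (@sum_identities _ (fun=> delta h)) //; apply: identities_gran.
rewrite in_fset_set // => /set_mem ide.
rewrite -[LHS]/(galg_mul (delta e) (delta h)) galg_mulE gmul_idl //.
by case: eqP.
Qed.

Fact galg_mul1r : right_id galg_one galg_mul.
Proof.
apply: galg_ext => [|a u v //|h]; first exact: galg_mul_linear_l.
pose F : {linear kG -> kG} := HB.pack (galg_mul (delta h))
  (GRing.isLinear.Build _ _ _ _ (galg_mul (delta h)) (galg_mul_linear_r _)).
rewrite -[LHS]/(F galg_one) galg_oneE linear_sum.
rewrite (eq_big_seq (fun e => if e == gdom h then delta h else 0)) => [|e].
  by rewrite (@sum_identities _ (fun=> delta h)) //; apply: identities_gdom.
rewrite in_fset_set // => /set_mem ide.
rewrite -[LHS]/(galg_mul (delta h) (delta e)) galg_mulE gmul_idr //.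
by case: eqP.
Qed.

Fact galg_mulDl : left_distributive galg_mul +%R.
Proof. by move=> u v w; have := galg_mul_linear_l w 1 u v; rewrite !scale1r. Qed.

Fact galg_mulDr : right_distributive galg_mul +%R.
Proof. by move=> u v w; have := galg_mul_linear_r u 1 v w; rewrite !scale1r. Qed.

Lemma delta_neq0 g : delta g != 0.
Proof. by rewrite /delta monalgU_eq0 oner_eq0. Qed.

Fact galg_one_neq0 : galg_one != 0.
Proof.
case: (@groupoid_nonempty G) => g _; apply: contra_not_neq (negP (delta_neq0 g)).
move=> one0; apply/eqP; rewrite -[LHS]galg_mul1l one0.
exact: linear_at0 (galg_mul_linear_l _).
Qed.

HB.instance Definition _ := GRing.Zmodule_isNzRing.Build kG
  galg_mulA galg_mul1l galg_mul1r galg_mulDl galg_mulDr galg_one_neq0.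

Fact galg_scaleAl (a : k) (u v : kG) : a *: (u * v) = (a *: u) * v.
Proof. by symmetry; apply: linear_atZ (galg_mul_linear_l v). Qed.

HB.instance Definition _ := GRing.Lmodule_isLalgebra.Build k kG galg_scaleAl.

Fact galg_scaleAr (a : k) (u v : kG) : a *: (u * v) = u * (a *: v).
Proof. by symmetry; apply: linear_atZ (galg_mul_linear_r u). Qed.

HB.instance Definition _ := GRing.Lalgebra_isAlgebra.Build k kG galg_scaleAr.

Lemma deltaM g h : delta g * delta h = delta_opt (gmul g h).
Proof. exact: galg_mulE. Qed.

Lemma galg1E : 1 = \sum_(e \in identities G) delta e :> kG.
Proof. by []. Qed.

Definition galg_comul : kG -> (kG ⊗ kG)%type := mext (fun g => delta g ⊗ delta g).
Definition galg_counit : kG -> k := mext (fun=> 1 : k^o).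
Definition galg_antipode : kG -> kG := mext (fun g => delta (ginv g)).

HB.instance Definition _ := GRing.isLinear.Build k kG (kG ⊗ kG)%type *:%R
  galg_comul (mext_is_linear _).
Fact galg_counit_is_scalar : scalar galg_counit.
Proof. exact: (@mext_is_linear k G k^o). Qed.

HB.instance Definition _ := GRing.isLinear.Build k kG k *%R
  galg_counit galg_counit_is_scalar.
HB.instance Definition _ := GRing.isLinear.Build k kG kG *:%R
  galg_antipode (mext_is_linear _).


Lemma galg_comulE g : galg_comul (delta g) = delta g ⊗ delta g.
Proof. by rewrite /galg_comul mextU. Qed.

Lemma galg_counitE g : galg_counit (delta g) = 1.
Proof. by rewrite /galg_counit (@mextU k G k^o). Qed.

Lemma galg_antipodeE g : galg_antipode (delta g) = delta (ginv g).
Proof. by rewrite /galg_antipode mextU. Qed.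

Fact galg_comulA c : tassoc (tmap idfun galg_comul (galg_comul c)) =
                     tmap galg_comul idfun (galg_comul c).
Proof.
have lc : linear galg_comul by exact: mext_is_linear.
have li : linear (@idfun kG) by [].
move: c; apply: galg_ext => [a u v|a u v|g].
- by rewrite lc (tmap_linear li lc) (@tassoc_linear k kG kG kG).
- by rewrite lc (tmap_linear lc li).
rewrite galg_comulE (tmapE li lc) (tmapE lc li) galg_comulE.
by rewrite (@tassocE k kG kG kG).
Qed.

Fact galg_counitl c :
  tlift (fun c1 c2 => galg_counit c1 *: c2) (galg_comul c) = c.
Proof.
set f := fun c1 c2 => _.
have fl y : linear (f^~ y).
  by move=> a u v; rewrite /f linearP scalerDl scalerA.
have fr x : linear (f x).
  by move=> a u v; rewrite /f scalerDr !scalerA mulrC.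
move: c; apply: galg_ext => // [a u v|g]; first by rewrite linearP tlift_linear.
by rewrite galg_comulE tliftE // /f galg_counitE scale1r.
Qed.

Fact galg_counitr c :
  tlift (fun c1 c2 => galg_counit c2 *: c1) (galg_comul c) = c.
Proof.
set f := fun c1 c2 => _.
have fr x : linear (f x).
  by move=> a u v; rewrite /f linearP scalerDl scalerA.
have fl y : linear (f^~ y).
  by move=> a u v; rewrite /f scalerDr !scalerA mulrC.
move: c; apply: galg_ext => // [a u v|g]; first by rewrite linearP tlift_linear.
by rewrite galg_comulE tliftE // /f galg_counitE scale1r.
Qed.

HB.instance Definition _ := Lmodule_isCoalgebra.Build k kG
  galg_comulA galg_counitl galg_counitr.

Section Sweedler.
Context {U : lmodType k} (f : kG -> kG -> U).
Hypotheses (fl : forall y, linear (f^~ y)) (fr : forall x, linear (f x)).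

Lemma sweedler_linear : linear (fun u => \sweedler_(x, y <- u) (f x y)).
Proof. by move=> a u v; rewrite linearP tlift_linear. Qed.

Lemma sweedler_delta g :
  \sweedler_(x, y <- delta g) (f x y) = f (delta g) (delta g).
Proof. by rewrite [comul _]galg_comulE tliftE. Qed.

Lemma sweedler_one : \sweedler_(x, y <- (1 : kG)) (f x y) =
  \sum_(e <- fset_set (identities G)) f (delta e) (delta e).
Proof.
pose F : {linear kG -> U} := HB.pack (fun u => \sweedler_(x, y <- u) (f x y))
  (GRing.isLinear.Build _ _ _ _ (fun u => \sweedler_(x, y <- u) (f x y)) sweedler_linear).
rewrite -[LHS]/(F 1) galg1E -/(galg_one) galg_oneE linear_sum.
by apply: eq_bigr => e _; apply: sweedler_delta.
Qed.

End Sweedler.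

End GroupoidAlgebra.

Section GroupoidWeakHopf.
Context (k : fieldType) (G : groupoidType) (fG : finite_set (identities G)).
Local Notation kG := (groupoid_algebra k fG).
Local Notation delta := (@delta k G fG).
Local Notation delta_opt := (@delta_opt k G fG).

Lemma gran_gmul (g h x : G) : gmul g h = Some x -> gran x = gran g.
Proof.
move=> ghx; have := gmulA (gran g) g h; rewrite gmul_ran ghx /= ghx => Ex.
by rewrite -(gdom_gran g); apply/esym/gmul_defined; rewrite Ex.
Qed.

Lemma gran_ginv (g : G) : gran (ginv g) = gdom g.
Proof. by rewrite -(gran_gmul (gmulVg g)) gran_gdom. Qed.

Let mulL (y : kG) : linear (fun x : kG => x * y).
Proof. by move=> a u v; rewrite mulrDl scalerAl. Qed.

Let mulR (x : kG) : linear (fun y : kG => x * y).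
Proof. by move=> a u v; rewrite mulrDr scalerAr. Qed.

Let comul_lin : linear (comul : kG -> _).
Proof. by move=> a u v; rewrite linearP. Qed.

Let counit_lin : linear (counit : kG -> k^o).
Proof. by move=> a u v; rewrite linearP. Qed.

Lemma counit_delta_opt (o : option G) : counit (delta_opt o) = (isSome o)%:R :> k.
Proof. by case: o => [g|]; [exact: galg_counitE | rewrite linear0]. Qed.

Lemma counit_deltaM (g h : G) : counit (delta g * delta h) = (isSome (gmul g h))%:R :> k.
Proof. by rewrite deltaM counit_delta_opt. Qed.

Fact galg_comulM (x y : kG) : comul (x * y) =
  \sweedler_(x1, x2 <- x) \sweedler_(y1, y2 <- y) ((x1 * y1) ⊗ (x2 * y2)).
Proof.
have bl1 (x1 x2 y2 : kG) : linear (fun y1 => (x1 * y1) ⊗ (x2 * y2)).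
  by move=> a u v; rewrite mulR tens_linear_l.
have bl2 (x1 x2 y1 : kG) : linear (fun y2 => (x1 * y1) ⊗ (x2 * y2)).
  by move=> a u v; rewrite mulR tens_linear_r.
have bl3 (z x2 : kG) :
    linear (fun x1 => \sweedler_(y1, y2 <- z) ((x1 * y1) ⊗ (x2 * y2))).
  by apply: tlift_linear_fun => y1 y2 a u v; rewrite mulL tens_linear_l.
have bl4 (z x1 : kG) :
    linear (fun x2 => \sweedler_(y1, y2 <- z) ((x1 * y1) ⊗ (x2 * y2))).
  by apply: tlift_linear_fun => y1 y2 a u v; rewrite mulL tens_linear_r.
move: x; apply: galg_ext => [a u v|a u v|g].
- by rewrite mulL comul_lin.
- exact: (sweedler_linear (bl3 y) (bl4 y)).
rewrite (sweedler_delta (bl3 y) (bl4 y)); move: y; apply: galg_ext => [a u v|a u v|h].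
- by rewrite mulR comul_lin.
- exact: sweedler_linear.
rewrite (sweedler_delta (bl1 _ _) (bl2 _ _)) deltaM.
case: (gmul g h) => [x|] /=; first exact: galg_comulE.
by rewrite linear0 (linear_at0 (tens_linear_r _)).
Qed.

Fact galg_counitM (x y z : kG) :
  (counit (x * y * z) =
   \sweedler_(y1, y2 <- y) (counit (x * y1) * counit (y2 * z) : k^o)) /\
  (counit (x * y * z) =
   \sweedler_(y1, y2 <- y) (counit (x * y2) * counit (y1 * z) : k^o)).
Proof.
have cL (w : kG) : linear (fun x : kG => counit (x * w) : k^o).
  by move=> a u v; rewrite mulL counit_lin.
have cR (w : kG) : linear (fun x : kG => counit (w * x) : k^o).
  by move=> a u v; rewrite mulR counit_lin.
have sL (c : k) (f : kG -> k^o) : linear f -> linear (fun x => f x * c : k^o).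
  by move=> lf a u v; rewrite lf mulrDl; congr (_ + _); rewrite -[LHS]mulrA.
have sR (c : k) (f : kG -> k^o) : linear f -> linear (fun x => c * f x : k^o).
  by move=> lf a u v; rewrite lf mulrDr; congr (_ + _); exact: mulrCA.
have def3 (f g h : G) : counit (delta f * delta g * delta h) =
    counit (delta f * delta g) * counit (delta g * delta h) :> k.
  rewrite !counit_deltaM deltaM.
  case E: (gmul f g) => [fg|] /=; last by rewrite !mul0r linear0.
  rewrite counit_deltaM mul1r; congr (_%:R); congr nat_of_bool.
  have := gmulA f g h; rewrite E /= => <-.
  case F: (gmul g h) => [gh|//] /=; apply/gmul_defined.
  by rewrite (gran_gmul F); apply/gmul_defined; rewrite E.
split.
- move: z; apply: (@galg_ext k G fG k^o) => [||h]; first exact: cR.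
    by apply: (tlift_linear_fun (F := fun z y1 y2 : kG => counit (x * y1) * counit (y2 * z) : k^o)) =>
      y1 y2; apply: sR; apply: cR.
  move: x; apply: (@galg_ext k G fG k^o) => [a u v||f].
  + by rewrite !mulL counit_lin.
  + by apply: (tlift_linear_fun (F := fun x y1 y2 : kG => counit (x * y1) * counit (y2 * delta h) : k^o)) =>
      y1 y2; apply: sL; apply: cL.
  have l1 (y2 : kG) : linear (fun y1 => counit (delta f * y1) * counit (y2 * delta h) : k^o).
    by apply: sL; apply: cR.
  have l2 (y1 : kG) : linear (fun y2 => counit (delta f * y1) * counit (y2 * delta h) : k^o).
    by apply: sR; apply: cL.
  move: y; apply: (@galg_ext k G fG k^o) => [a u v|a u v|g].
  + by rewrite mulR mulL counit_lin.
  + exact: (@sweedler_linear k G fG k^o _ l1 l2).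
  by rewrite (@sweedler_delta k G fG k^o _ l1 l2) def3.
- move: z; apply: (@galg_ext k G fG k^o) => [||h]; first exact: cR.
    by apply: (tlift_linear_fun (F := fun z y1 y2 : kG => counit (x * y2) * counit (y1 * z) : k^o)) =>
      y1 y2; apply: sR; apply: cR.
  move: x; apply: (@galg_ext k G fG k^o) => [a u v||f].
  + by rewrite !mulL counit_lin.
  + by apply: (tlift_linear_fun (F := fun x y1 y2 : kG => counit (x * y2) * counit (y1 * delta h) : k^o)) =>
      y1 y2; apply: sL; apply: cL.
  have l1 (y2 : kG) : linear (fun y1 => counit (delta f * y2) * counit (y1 * delta h) : k^o).
    by apply: sR; apply: cL.
  have l2 (y1 : kG) : linear (fun y2 => counit (delta f * y2) * counit (y1 * delta h) : k^o).
    by apply: sL; apply: cR.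
  move: y; apply: (@galg_ext k G fG k^o) => [a u v|a u v|g].
  + by rewrite mulR mulL counit_lin.
  + exact: (@sweedler_linear k G fG k^o _ l1 l2).
  by rewrite (@sweedler_delta k G fG k^o _ l1 l2) def3.
Qed.

Let idem (e e' : G) : identities G e -> identities G e' ->
  delta e * delta e' = if e' == e then delta e else 0.
Proof.
move=> ie ie'; rewrite deltaM gmul_idr // (identity_gdom ie).
by case: eqP.
Qed.

Fact galg_comul1 :
  (tmap comul idfun (comul (1 : kG)) =
   \sweedler_(a, b <- (1 : kG)) \sweedler_(c, d <- (1 : kG)) ((a ⊗ (b * c)) ⊗ d)) /\
  (tmap comul idfun (comul (1 : kG)) =
   \sweedler_(a, b <- (1 : kG)) \sweedler_(c, d <- (1 : kG)) ((a ⊗ (c * b)) ⊗ d)).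
Proof.
have li : linear (@idfun kG) by [].
have -> : tmap comul idfun (comul (1 : kG)) =
    \sum_(e <- fset_set (identities G)) delta e ⊗ delta e ⊗ delta e.
  pose F : {linear kG -> (kG ⊗ kG ⊗ kG)%type} :=
    HB.pack (fun c : kG => tmap comul idfun (comul c))
    (GRing.isLinear.Build _ _ _ _ (fun c : kG => tmap comul idfun (comul c))
      (fun a u v => etrans (congr1 _ (comul_lin a u v)) (tmap_linear comul_lin li a _ _))).
  rewrite -[LHS]/(F 1) galg1E -/(galg_one k fG) galg_oneE linear_sum.
  apply: eq_bigr => e _; rewrite -[LHS]/(tmap comul idfun (comul (delta e))).
  by rewrite [comul _]galg_comulE (tmapE comul_lin li) [comul _]galg_comulE.
have swap (m : kG -> kG -> kG) : (forall y, linear (m^~ y)) ->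
  (forall x, linear (m x)) -> (forall e e', identities G e -> identities G e' ->
    m (delta e) (delta e') = if e' == e then delta e else 0) ->
  \sum_(e <- fset_set (identities G)) delta e ⊗ delta e ⊗ delta e =
  \sweedler_(a, b <- (1 : kG)) \sweedler_(c, d <- (1 : kG)) ((a ⊗ m b c) ⊗ d).
  move=> mL mR me.
  have l1 (b d a : kG) : linear (fun c : kG => a ⊗ m b c ⊗ d).
    by move=> z u v; rewrite mR tens_linear_r tens_linear_l.
  have l2 (b c a : kG) : linear (fun d : kG => a ⊗ m b c ⊗ d).
    by move=> z u v; rewrite tens_linear_r.
  have l3 (b : kG) : linear (fun a : kG => \sweedler_(c, d <- (1 : kG)) (a ⊗ m b c ⊗ d)).
    by apply: tlift_linear_fun => c d z u v; rewrite !tens_linear_l.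
  have l4 (a : kG) : linear (fun b : kG => \sweedler_(c, d <- (1 : kG)) (a ⊗ m b c ⊗ d)).
    by apply: tlift_linear_fun => c d z u v; rewrite mL tens_linear_r tens_linear_l.
  rewrite (sweedler_one l3 l4); apply: eq_big_seq => e.
  rewrite in_fset_set // => /set_mem ide.
  rewrite (sweedler_one (fun d => l1 _ d _) (fun c => l2 _ c _)).
  rewrite -[LHS](sum_identities fG (fun f => delta e ⊗ delta e ⊗ delta f) ide).
  apply: eq_big_seq => f; rewrite in_fset_set // => /set_mem idf.
  rewrite me //; case: eqP => // _.
  by rewrite (linear_at0 (tens_linear_r _)) (linear_at0 (tens_linear_l _)).
split; first exact: (swap *%R).
apply: (swap (fun b c => c * b)) => // e e' ie ie'; rewrite idem // eq_sym.
by case: eqP => // ->.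
Qed.

Local Notation S := (@galg_antipode k G fG).

Let S_lin : linear S. Proof. exact: mext_is_linear. Qed.

Fact galg_antipodel (h : kG) : \sweedler_(h1, h2 <- h) (h1 * S h2) =
  \sweedler_(a, b <- (1 : kG)) (counit (a * h) *: b).
Proof.
have l1 (h2 : kG) : linear (fun h1 : kG => h1 * S h2) by exact: mulL.
have l2 (h1 : kG) : linear (fun h2 : kG => h1 * S h2).
  by move=> a u v; rewrite S_lin mulR.
have l3 (w b : kG) : linear (fun a : kG => counit (a * w) *: b).
  by move=> z u v; rewrite mulL counit_lin scalerDl scalerA.
have l4 (w a : kG) : linear (fun b : kG => counit (a * w) *: b).
  by move=> z u v; rewrite scalerDr !scalerA mulrC.
move: h; apply: galg_ext => [||g].
- exact: sweedler_linear.
- by apply: tlift_linear_fun => a b z u v; rewrite mulR counit_lin scalerDl scalerA.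
rewrite (sweedler_delta l1 l2) (sweedler_one (l3 _) (l4 _)) galg_antipodeE.
rewrite deltaM gmulgV -[LHS](sum_identities fG delta (identities_gran g)).
apply: eq_big_seq => e; rewrite in_fset_set // => /set_mem ide.
by rewrite counit_deltaM gmul_idl //; case: eqP; rewrite ?scale1r ?scale0r.
Qed.

Fact galg_antipoder (h : kG) : \sweedler_(h1, h2 <- h) (S h1 * h2) =
  \sweedler_(a, b <- (1 : kG)) (counit (h * b) *: a).
Proof.
have l1 (h1 : kG) : linear (fun h2 : kG => S h1 * h2) by exact: mulR.
have l2 (h2 : kG) : linear (fun h1 : kG => S h1 * h2).
  by move=> a u v; rewrite S_lin mulL.
have l3 (w a : kG) : linear (fun b : kG => counit (w * b) *: a).
  by move=> z u v; rewrite mulR counit_lin scalerDl scalerA.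
have l4 (w b : kG) : linear (fun a : kG => counit (w * b) *: a).
  by move=> z u v; rewrite scalerDr !scalerA mulrC.
move: h; apply: galg_ext => [||g].
- exact: sweedler_linear.
- by apply: tlift_linear_fun => a b z u v; rewrite mulL counit_lin scalerDl scalerA.
rewrite (sweedler_delta l2 l1) (sweedler_one (l4 _) (l3 _)) galg_antipodeE.
rewrite deltaM gmulVg -[LHS](sum_identities fG delta (identities_gdom g)).
apply: eq_big_seq => e; rewrite in_fset_set // => /set_mem ide.
by rewrite counit_deltaM gmul_idr //; case: eqP; rewrite ?scale1r ?scale0r.
Qed.

Fact galg_antipodeM (h : kG) :
  \sweedler_(h1, h' <- h) \sweedler_(h2, h3 <- h') (S h1 * h2 * S h3) = S h.
Proof.
have l1 (h1 h3 : kG) : linear (fun h2 : kG => S h1 * h2 * S h3).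
  by move=> a u v; rewrite mulR mulL.
have l2 (h1 h2 : kG) : linear (fun h3 : kG => S h1 * h2 * S h3).
  by move=> a u v; rewrite S_lin mulR.
have l3 (h' : kG) : linear (fun h1 : kG => \sweedler_(h2, h3 <- h') (S h1 * h2 * S h3)).
  by apply: tlift_linear_fun => h2 h3 a u v; rewrite S_lin !mulL.
have l4 (h1 : kG) : linear (fun h' : kG => \sweedler_(h2, h3 <- h') (S h1 * h2 * S h3)).
  exact: sweedler_linear.
move: h; apply: galg_ext => [||g]; [exact: sweedler_linear | exact: S_lin |].
rewrite (sweedler_delta l3 l4) (sweedler_delta (l1 _) (l2 _)) galg_antipodeE.
by rewrite deltaM gmulVg /= deltaM -gran_ginv gmul_ran.
Qed.

HB.instance Definition _ := isWeakHopfAlgebra.Build k kG galg_comulM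
  (fun x y z => (galg_counitM x y z).1) (fun x y z => (galg_counitM x y z).2)
  galg_comul1.1 galg_comul1.2 galg_antipodel galg_antipoder galg_antipodeM.

End GroupoidWeakHopf.

Section PartialModuleCoalgebra.
Context {k : fieldType} {H : weakHopfAlgType k} {C : coalgType k}.
Variable act : {linear (H ⊗ C)%type -> C}.
Local Notation "h '⋅' c" := (act (h ⊗ c)) (at level 36, right associativity).

Definition partial_module_coalgebra : Prop :=
  [/\ forall c : C, 1 ⋅ c = c,
      forall (h : H) (c : C), comul (h ⋅ c) =
        \sweedler_(h1, h2 <- h) \sweedler_(c1, c2 <- c) ((h1 ⋅ c1) ⊗ (h2 ⋅ c2))
    & forall (h l : H) (c : C), h ⋅ l ⋅ c =
        \sweedler_(l1, l2 <- l) \sweedler_(c1, c2 <- c)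
          (counit (l2 ⋅ c2) *: ((h * l1) ⋅ c1))].

Definition symmetric_partial_module_coalgebra : Prop :=
  partial_module_coalgebra /\
  forall (h l : H) (c : C), h ⋅ l ⋅ c =
    \sweedler_(l1, l2 <- l) \sweedler_(c1, c2 <- c)
      (counit (l1 ⋅ c1) *: ((h * l2) ⋅ c2)).

End PartialModuleCoalgebra.

Section PartialAction.
Context {k : fieldType}.

Definition subcoalgebra {C : coalgType k} (D : set C) : Prop :=
  submod_closed [pred c | c \in D] /\
  forall c, D c -> exists s : seq (C * C),
    (forall p, p \in s -> D p.1 /\ D p.2) /\
    comul c = \sum_(p <- s) p.1 ⊗ p.2.

(* A linear map D -> E between subcoalgebras of C is represented by a linear
   endomorphism f of C of which only the restriction to D matters; over a field
   every linear map on the subspace D has such an extension. *)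
Definition coalgebra_iso {C : coalgType k} (D E : set C) (f : {linear C -> C}) :
    Prop :=
  [/\ set_bij D E f,
      forall c, D c -> comul (f c) = tmap f f (comul c)
    & forall c, D c -> counit (f c) = counit c].

Definition linear_projection {V : lmodType k} (D : set V) (P : {linear V -> V}) :
    Prop :=
  (forall v, P (P v) = P v) /\ range P = D.

Context {G : groupoidType} {C : coalgType k}.
Variables (D : G -> set C) (theta : G -> {linear C -> C}).

Definition partial_action : Prop :=
  [/\ forall g, subcoalgebra (D g),
      forall g, coalgebra_iso (D (ginv g)) (D g) (theta g)
    & exists P : G -> {linear C -> C},
      [/\ forall g,
            [/\ linear_projection (D g) (P g),
                forall c, tmap (P g) (P g) (comul c) = comul (P g c),
                forall c, P g c =
                  \sweedler_(c1, c2 <- c) (counit (P g c2) *: P (gran g) c1)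
              & forall c, P g c =
                  \sweedler_(c1, c2 <- c) (counit (P g c1) *: P (gran g) c2)],
          forall e c, identities G e -> D e c -> theta e c = c,
          forall g h c, P g (P h c) = P h (P g c),
          forall g h gh c, gmul g h = Some gh ->
            theta (ginv h) (P h (P (ginv g) c)) =
            P (ginv gh) (theta (ginv h) (P h c))
        & forall g h gh c, gmul g h = Some gh ->
            theta g (theta h (P (ginv gh) (P (ginv h) c))) =
            theta gh (P (ginv gh) (P (ginv h) c))]].

(* C is the direct sum of the subspaces D e over the identities e, of which
   there are finitely many. *)
Definition direct_sum_identities : Prop :=
  forall c, exists! x : G -> C,
    [/\ forall e, identities G e -> D e (x e),
        forall g, ~ identities G g -> x g = 0
      & c = \sum_(e \in identities G) x e].

End PartialAction.

(* Main.v *)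
(* Write T_g for the action of delta_g.  From a symmetric partial action of the
   algebra, P_g = T_g T_{g^-1} is T_{r(g)} composed with a slice
   c |-> c_1 eps(P_g c_2), or equally c |-> eps(P_g c_1) c_2.  The two kinds of
   slices commute by coassociativity, hence so do the P_g; the remaining axioms
   follow from T_g T_h = T_{gh} P_{h^-1}, with theta_g = T_g and C_g = P_g(C).
   Conversely, put T_g = theta_g P_{g^-1}: directness of the sum makes the P_e
   orthogonal idempotents with sum 1, and the axioms on theta give
   T_g T_h = theta_{gh} P_{(gh)^-1} P_{h^-1}. *)
Require Import Defs.
From HB Require Import structures.
From mathcomp Require Import all_boot all_order all_algebra.
From mathcomp Require Import boolp classical_sets functions cardinality fsbigop.
From mathcomp Require Import finmap.

Set Implicit Arguments.
Unset Strict Implicit.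
Unset Printing Implicit Defensive.

Import GRing.Theory.
Local Open Scope ring_scope.

(** * Inverses and cancellation in a groupoid *)

Section GroupoidInverse.
Context {G : groupoidType}.
Implicit Types g h x e : G.

Lemma gdom_ginv g : gdom (ginv g) = gran g.
Proof. by apply/gmul_defined; rewrite gmulVg. Qed.

Lemma ginv_identity e : identities G e -> ginv e = e.
Proof.
move=> ide; have := gmulVg e; rewrite gmul_idr // (identity_gdom ide).
by case: eqP => // _ [].
Qed.

Lemma gdom_gmul g h x : gmul g h = Some x -> gdom x = gdom h.
Proof.
move=> ghx; have := gmulA g h (gdom h); rewrite gmul_dom ghx /= ghx => Ex.
by rewrite -[RHS]gran_gdom; apply/gmul_defined; rewrite -Ex.
Qed.

Lemma gmul_gdom_gran g h x : gmul g h = Some x -> gdom g = gran h.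
Proof. by move=> ghx; apply/gmul_defined; rewrite ghx. Qed.

Lemma gmulK g h x : gmul g h = Some x -> gmul x (ginv h) = Some g.
Proof.
move=> ghx; have := gmulA g h (ginv h); rewrite ghx gmulgV /= => <-.
by rewrite -(gmul_gdom_gran ghx) gmul_dom.
Qed.

Lemma gmul_ginv_mull g h x : gmul g h = Some x -> gmul (ginv x) g = Some (ginv h).
Proof.
move=> ghx; have := gmulA (ginv x) x (ginv h).
rewrite (gmulK ghx) gmulVg /= => ->.
by rewrite (gdom_gmul ghx) -gran_ginv gmul_ran.
Qed.

(** Cancellation in g g^-1 = r(g) gives r(g)^-1 g = (g^-1)^-1, and the identity r(g) is its own
    inverse. *)
Lemma ginvK : involutive (@ginv G).
Proof.
move=> g; have := gmul_ginv_mull (gmulgV g).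
by rewrite (ginv_identity (identities_gran g)) gmul_ran => -[].
Qed.

End GroupoidInverse.

(** * Functoriality of the tensor product *)

Section TensorFunctionals.
Context {k : fieldType} {V W U : lmodType k}.

Lemma eq_tlift (f f' : V -> W -> U) t : f =2 f' -> tlift f t = tlift f' t.
Proof.
by move=> e; rewrite tlift.unlock mext.unlock; apply: eq_bigr => p _; rewrite e.
Qed.

Lemma linear_tlift {U' : lmodType k} (L : U -> U') (f : V -> W -> U) t :
  linear L -> L (tlift f t) = tlift (fun x y => L (f x y)) t.
Proof.
move=> lL; pose F : {linear U -> U'} := HB.pack L (GRing.isLinear.Build _ _ _ _ L lL).
rewrite tlift.unlock mext.unlock -[L _]/(F _) linear_sum.
by apply: eq_bigr => p _; rewrite linearZ.
Qed.

End TensorFunctionals.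

Lemma tlift_tmap {k : fieldType} {V V' W W' U : lmodType k} (f : V' -> W' -> U)
    (a : V -> V') (b : W -> W') t :
  (forall y, linear (f^~ y)) -> (forall x, linear (f x)) ->
  linear a -> linear b ->
  tlift f (tmap a b t) = tlift (fun x y => f (a x) (b y)) t.
Proof.
move=> fl fr la lb; rewrite /tmap (linear_tlift (L := tlift f)); last exact: tlift_linear.
by apply: eq_tlift => x y; rewrite tliftE.
Qed.

Lemma tmap_comp {k : fieldType} {V V' V'' W W' W'' : lmodType k}
    (f : V' -> V'') (f' : V -> V') (g : W' -> W'') (g' : W -> W') t :
  linear f -> linear f' -> linear g -> linear g' ->
  tmap f g (tmap f' g' t) = tmap (f \o f') (g \o g') t.
Proof.
move=> lf lf' lg lg'; rewrite /tmap; apply: tlift_tmap => // [y|x] a u v.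
  by rewrite lf tens_linear_l.
by rewrite lg tens_linear_r.
Qed.

Lemma eq_tmap {k : fieldType} {V V' W W' : lmodType k} (f f' : V -> V')
    (g g' : W -> W') t : f =1 f' -> g =1 g' -> tmap f g t = tmap f' g' t.
Proof. by move=> ef eg; apply: eq_tlift => x y; rewrite ef eg. Qed.

(** * Slicing the comultiplication by functionals *)

Section Slices.
Context {k : fieldType} {C : coalgType k}.
Implicit Types (phi psi : C -> k) (c : C).

(** [slicel] and [slicer] are the right and left actions of the convolution algebra C^* on C. *)
Definition slicel phi c : C := \sweedler_(x, y <- c) (phi x *: y).
Definition slicer phi c : C := \sweedler_(x, y <- c) (phi y *: x).

Let scalel phi : scalar phi -> forall y : C, linear (fun x => phi x *: y).
Proof. by move=> lp y a u v; rewrite lp scalerDl scalerA. Qed.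

Let scaler (b : k) : linear (fun y : C => b *: y).
Proof. by move=> a u v; rewrite scalerDr !scalerA mulrC. Qed.

Let comul_lin : linear (comul : C -> _).
Proof. exact: linearP. Qed.

Lemma slicel_linear phi : scalar phi -> linear (slicel phi).
Proof.
move=> lp a u v; rewrite /slicel linearP tlift_linear // => y; exact: scalel.
Qed.

Lemma slicer_linear phi : scalar phi -> linear (slicer phi).
Proof.
move=> lp a u v; rewrite /slicer linearP tlift_linear // => y; exact: scalel.
Qed.

Lemma eq_slicel phi psi c : phi =1 psi -> slicel phi c = slicel psi c.
Proof. by move=> e; apply: eq_tlift => x y; rewrite e. Qed.

Lemma eq_slicer phi psi c : phi =1 psi -> slicer phi c = slicer psi c.
Proof. by move=> e; apply: eq_tlift => x y; rewrite e. Qed.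

Lemma linear_slicel {U : lmodType k} (L : C -> U) phi c : linear L ->
  L (slicel phi c) = \sweedler_(x, y <- c) (phi x *: L y).
Proof.
move=> lL; rewrite /slicel linear_tlift //.
by apply: eq_tlift => x y; rewrite linear_atZ.
Qed.

Lemma linear_slicer {U : lmodType k} (L : C -> U) phi c : linear L ->
  L (slicer phi c) = \sweedler_(x, y <- c) (phi y *: L x).
Proof.
move=> lL; rewrite /slicer linear_tlift //.
by apply: eq_tlift => x y; rewrite linear_atZ.
Qed.

(* This is coassociativity: both sides are phi(c_1) psi(c_3) c_2. *)
Lemma slicelC phi psi c : scalar phi -> scalar psi ->
  slicer psi (slicel phi c) = slicel phi (slicer psi c).
Proof.
move=> lp lq; have li : linear (@idfun C) by [].
(* [tlift f] contracts the outer factors of (x ⊗ y) ⊗ z with [phi] and [psi] and keeps y; it is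
   applied to both sides of coassociativity. *)
pose f (t : (C ⊗ C)%type) (z : C) : C := psi z *: tlift (fun x y => phi x *: y) t.
have lt : linear (tlift (fun x y : C => phi x *: y)).
  by apply: tlift_linear => // y; apply: scalel.
have fl z : linear (f^~ z) by move=> a u v; rewrite /f lt scalerDr !scalerA mulrC.
have fr t : linear (f t) by move=> a u v; rewrite /f lq scalerDl scalerA.
have lF : linear (fun t => tlift f (@tassoc k C C C t)).
  by move=> a u v; rewrite (@tassoc_linear k C C C) (tlift_linear fl fr).
have := congr1 (tlift f) (comulA c).
rewrite (tlift_tmap _ fl fr comul_lin li) /f /= => E.
rewrite (linear_slicer _ _ (slicel_linear lp)) -E.
rewrite (linear_slicel _ _ (slicer_linear lq)).
rewrite (linear_tlift (fun x y => idfun x ⊗ comul y) _ lF).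
apply: eq_tlift => x y; rewrite /slicer.
have lx : linear (fun t : (C ⊗ C)%type => tlift f (tassoc (x ⊗ t))).
  by move=> a u v; rewrite tens_linear_r lF.
have ly : linear (fun t : (C ⊗ C)%type => phi x *: tlift (fun x y => psi y *: x) t).
  move=> a u v; rewrite tlift_linear //; last by move=> ?; apply: scalel.
  by rewrite scalerDr !scalerA mulrC.
apply/esym; apply: (tensor_ext lx ly) => u v.
rewrite tassocE (tliftE fl fr) /f !tliftE //; try by move=> ?; apply: scalel.
by rewrite !scalerA mulrC.
Qed.

Lemma counit_linear_scalar (f : {linear C -> C}) : scalar (fun c => counit (f c)).
Proof. by move=> a u v; rewrite !linearP. Qed.

(** Comultiplicativity turns f(c_1) eps(f(c_2)) into the counit axiom for f(c); this lets a map
    absorb its own slice. *)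
Lemma slicer_counit (f : {linear C -> C}) c :
  comul (f c) = tmap f f (comul c) -> f (slicer (fun x => counit (f x)) c) = f c.
Proof.
move=> fc; rewrite linear_slicer; last exact: linearP.
rewrite -[RHS]counitr fc tlift_tmap //; try exact: linearP.
by move=> y a u v; rewrite linearP scalerDl scalerA.
Qed.

End Slices.

(** * Reduction of the module axioms to the basis of the groupoid algebra *)

Section PartialRep.
Context {k : fieldType} {G : groupoidType} (fG : finite_set (identities G)).
Context {C : coalgType k}.
Local Notation kG := (groupoid_algebra k fG).
Local Notation delta := (@delta k G fG).
Local Notation ids := (fset_set (identities G)).
Implicit Types (T : G -> {linear C -> C}) (g h x e : G) (c : C).

(* The axioms of a symmetric partial module coalgebra read off on the basis of
   the groupoid algebra, with [T g c = delta g ⋅ c]. *)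
Definition symmetric_partial_rep T : Prop :=
  [/\ forall c, \sum_(e <- ids) T e c = c,
      forall g c, comul (T g c) = tmap (T g) (T g) (comul c),
      forall g h x c, gmul g h = Some x ->
        T g (T h c) = T x (slicer (fun c => counit (T h c)) c),
      forall g h x c, gmul g h = Some x ->
        T g (T h c) = T x (slicel (fun c => counit (T h c)) c)
    & forall g h c, gmul g h = None -> T g (T h c) = 0].

Fact act_tens_linear (act : {linear (kG ⊗ C)%type -> C}) (u : kG) :
  linear (fun c => act (u ⊗ c)).
Proof. by move=> a c c'; rewrite tens_linear_r linearP. Qed.

Definition act_at (act : {linear (kG ⊗ C)%type -> C}) (u : kG) : {linear C -> C} :=
  HB.pack (fun c => act (u ⊗ c))
    (GRing.isLinear.Build _ _ _ _ (fun c => act (u ⊗ c)) (act_tens_linear act u)).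

Section Action.
Variable act : {linear (kG ⊗ C)%type -> C}.
Local Notation "h '⋅' c" := (act (h ⊗ c)) (at level 36, right associativity).

Let actl c : linear (fun u : kG => u ⋅ c).
Proof. by move=> a u v; rewrite tens_linear_l linearP. Qed.

Let actr u : linear (fun c : C => u ⋅ c).
Proof. exact: act_tens_linear. Qed.

Let counitL : linear (counit : C -> k^o).
Proof. exact: linearP. Qed.

(** Here and in the next two lemmas, the basis vector is group-like, so the outer Sweedler sum has a
    single term. *)
Lemma sweedler_delta_comul g c :
  \sweedler_(h1, h2 <- delta g) \sweedler_(c1, c2 <- c) ((h1 ⋅ c1) ⊗ (h2 ⋅ c2)) =
  tmap (act_at act (delta g)) (act_at act (delta g)) (comul c).
Proof.
rewrite sweedler_delta // => [h2|h1]; apply: tlift_linear_fun => c1 c2 a u v.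
- by rewrite actl tens_linear_l.
- by rewrite actl tens_linear_r.
Qed.

Lemma sweedler_delta_counitr u h c :
  \sweedler_(l1, l2 <- delta h) \sweedler_(c1, c2 <- c)
    (counit (l2 ⋅ c2) *: ((u * l1) ⋅ c1)) =
  (u * delta h) ⋅ (slicer (fun c => counit (delta h ⋅ c)) c).
Proof.
rewrite sweedler_delta; first by rewrite (linear_slicer _ _ (actr _)).
- move=> l2; apply: tlift_linear_fun => c1 c2 a v w.
  by rewrite mulrDr -scalerAr actl scalerDr !scalerA mulrC.
- move=> l1; apply: tlift_linear_fun => c1 c2 a v w.
  by rewrite actl counitL scalerDl scalerA.
Qed.

Lemma sweedler_delta_counitl u h c :
  \sweedler_(l1, l2 <- delta h) \sweedler_(c1, c2 <- c)
    (counit (l1 ⋅ c1) *: ((u * l2) ⋅ c2)) =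
  (u * delta h) ⋅ (slicel (fun c => counit (delta h ⋅ c)) c).
Proof.
rewrite sweedler_delta; first by rewrite (linear_slicel _ _ (actr _)).
- move=> l2; apply: tlift_linear_fun => c1 c2 a v w.
  by rewrite actl counitL scalerDl scalerA.
- move=> l1; apply: tlift_linear_fun => c1 c2 a v w.
  by rewrite mulrDr -scalerAr actl scalerDr !scalerA mulrC.
Qed.

Lemma act1E c : 1 ⋅ c = \sum_(e <- ids) delta e ⋅ c.
Proof.
pose F : {linear kG -> C} := HB.pack (fun u : kG => u ⋅ c)
  (GRing.isLinear.Build _ _ _ _ (fun u : kG => u ⋅ c) (actl c)).
by rewrite -[LHS]/(F 1) galg1E fsbig_finite // linear_sum.
Qed.

(** Every axiom is linear in each algebra argument, so basis vectors suffice; the two axioms on h ⋅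
    (l ⋅ c) then split according to whether the product is defined. *)
Lemma symmetric_partial_module_coalgebraE :
  symmetric_partial_module_coalgebra act <->
  symmetric_partial_rep (fun g => act_at act (delta g)).
Proof.
split=> [[[act1 actD actM] actS]|[act1 actD actMr actMl actM0]].
  split=> [c|g c|g h x c ghx|g h x c ghx|g h c gh].
  - by rewrite -[RHS]act1 act1E.
  - by rewrite /= actD sweedler_delta_comul.
  - by rewrite /= actM sweedler_delta_counitr deltaM ghx.
  - by rewrite /= actS sweedler_delta_counitl deltaM ghx.
  - by rewrite /= actM sweedler_delta_counitr deltaM gh /= (linear_at0 (actl _)).
(* [u] stands for the right-hand side of either axiom on h ⋅ (l ⋅ c). *)
have M (u : kG -> kG -> C -> C) : (forall (h : kG) c, linear (fun l => u h l c)) ->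
    (forall l c, linear (fun h : kG => u h l c)) ->
    (forall g h c, delta g ⋅ delta h ⋅ c = u (delta g) (delta h) c) ->
    forall (h l : kG) c, h ⋅ l ⋅ c = u h l c.
  move=> u1 u2 e h l c; move: h; apply: galg_ext => // g.
  move: l; apply: galg_ext => // a v w /=.
  by rewrite actl actr.
split; first split=> [c|h c|].
- by rewrite act1E; apply: act1.
- move: h; apply: galg_ext => [a u v|a u v|g].
  + by rewrite actl linearP.
  + rewrite linearP tlift_linear // => [h2|h1]; apply: tlift_linear_fun => c1 c2 b w z.
    * by rewrite actl tens_linear_l.
    * by rewrite actl tens_linear_r.
  + by rewrite sweedler_delta_comul; apply: actD.
- apply: M => [h c a u v|l c|g h c].
  + rewrite linearP tlift_linear // => [l2|l1]; apply: tlift_linear_fun => c1 c2 b w z.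
    * by rewrite mulrDr -scalerAr actl scalerDr !scalerA mulrC.
    * by rewrite actl counitL scalerDl scalerA.
  + apply: tlift_linear_fun => l1 l2; apply: tlift_linear_fun => c1 c2 a u v.
    by rewrite mulrDl -scalerAl actl scalerDr !scalerA mulrC.
  + rewrite sweedler_delta_counitr deltaM; case E: (gmul g h) => [x|] /=.
      exact: actMr E.
    by rewrite (linear_at0 (actl _)); apply: actM0.
- apply: M => [h c a u v|l c|g h c].
  + rewrite linearP tlift_linear // => [l2|l1]; apply: tlift_linear_fun => c1 c2 b w z.
    * by rewrite actl counitL scalerDl scalerA.
    * by rewrite mulrDr -scalerAr actl scalerDr !scalerA mulrC.
  + apply: tlift_linear_fun => l1 l2; apply: tlift_linear_fun => c1 c2 a u v.
    by rewrite mulrDl -scalerAl actl scalerDr !scalerA mulrC.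
  + rewrite sweedler_delta_counitl deltaM; case E: (gmul g h) => [x|] /=.
      exact: actMl E.
    by rewrite (linear_at0 (actl _)); apply: actM0.
Qed.

End Action.

(** Needed because the action built from [T] gives back each [T g] only up to pointwise equality. *)
Lemma eq_symmetric_partial_rep T T' : (forall g, T g =1 T' g) ->
  symmetric_partial_rep T -> symmetric_partial_rep T'.
Proof.
move=> e [T1 TD Tr Tl T0]; split=> [c|g c|g h x c ghx|g h x c ghx|g h c gh].
- by rewrite -[RHS]T1; apply: eq_bigr => i _; rewrite e.
- by rewrite -e TD; apply: eq_tmap.
- by rewrite -!e (Tr _ _ _ _ ghx); congr (T _ _); apply: eq_slicer => y; rewrite e.
- by rewrite -!e (Tl _ _ _ _ ghx); congr (T _ _); apply: eq_slicel => y; rewrite e.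
- by rewrite -!e T0.
Qed.

Lemma symmetric_partial_rep_act T : symmetric_partial_rep T ->
  exists act : {linear (kG ⊗ C)%type -> C}, symmetric_partial_module_coalgebra act.
Proof.
move=> repT; pose f (u : kG) c := mext (fun g => T g c) u.
have fl c : linear (f^~ c) by exact: mext_is_linear.
have fr (u : kG) : linear (f u).
  by apply: (mext_linear_r (F := fun g c => T g c)) => g; apply: linearP.
pose act : {linear (kG ⊗ C)%type -> C} := HB.pack (tlift f)
  (GRing.isLinear.Build _ _ _ _ (tlift f) (tlift_linear fl fr)).
exists act; apply/symmetric_partial_module_coalgebraE.
apply: eq_symmetric_partial_rep repT => g c.
by rewrite /= (tliftE fl fr) /f mextU.
Qed.

End PartialRep.

(** * From a symmetric partial module coalgebra to a partial action *)

Section RepToAction.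
Context {k : fieldType} {G : groupoidType} (fG : finite_set (identities G)).
Context {C : coalgType k} (T : G -> {linear C -> C}).
Hypothesis repT : symmetric_partial_rep T.
Implicit Types (g h x e : G) (c : C).
Local Notation counitT g := (fun c => counit (T g c)).

Let T1 : forall c, \sum_(e <- fset_set (identities G)) T e c = c.
Proof. by case: repT. Qed.

Let TD g c : comul (T g c) = tmap (T g) (T g) (comul c).
Proof. by case: repT. Qed.

Let Tr g h x c : gmul g h = Some x -> T g (T h c) = T x (slicer (counitT h) c).
Proof. by case: repT => _ _ H _ _; apply: H. Qed.

Let Tl g h x c : gmul g h = Some x -> T g (T h c) = T x (slicel (counitT h) c).
Proof. by case: repT => _ _ _ H _; apply: H. Qed.

Let T0 g h c : gdom g <> gran h -> T g (T h c) = 0.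
Proof.
case: repT => _ _ _ _ H ne; apply: H; case E: (gmul g h) => [x|//].
by case: ne; apply: gmul_gdom_gran E.
Qed.

(** Since r(g) g = g, the left side is T_g of the slice of c by eps T_g, which T_g absorbs. *)
Lemma rep_ran g c : T (gran g) (T g c) = T g c.
Proof. by rewrite (Tr _ (gmul_ran g)) slicer_counit. Qed.

(** In c = sum of the T_e c, the map T_g kills every term except e = d(g). *)
Lemma rep_dom g c : T g (T (gdom g) c) = T g c.
Proof.
rewrite -[in RHS](T1 c) linear_sum.
rewrite -(sum_identities fG (fun e => T g (T e c)) (identities_gdom g)).
apply: eq_big_seq => e; rewrite in_fset_set // => /set_mem ide.
by case: eqP => // ne; rewrite T0 // (identity_gran ide) => /esym.
Qed.

Definition rep_proj g : {linear C -> C} := T g \o T (ginv g).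

Lemma rep_projE g c : rep_proj g c = T g (T (ginv g) c). Proof. by []. Qed.

Lemma rep_projVE g c : rep_proj (ginv g) c = T (ginv g) (T g c).
Proof. by rewrite rep_projE ginvK. Qed.

Lemma rep_projVr g c : rep_proj (ginv g) c = T (gdom g) (slicer (counitT g) c).
Proof. by rewrite rep_projVE (Tr _ (gmulVg g)). Qed.

Lemma rep_projVl g c : rep_proj (ginv g) c = T (gdom g) (slicel (counitT g) c).
Proof. by rewrite rep_projVE (Tl _ (gmulVg g)). Qed.

(** Both sides equal eps(T_(d(g)) c_1) eps(T_g c_2): the left by the right-slice form of P_(g^-1),
    the right by the symmetry axiom applied to T_g = T_g T_(d(g)). *)
Lemma counit_rep_proj g c : counit (rep_proj (ginv g) c) = counit (T g c).
Proof.
rewrite rep_projVr -(rep_dom g c) (Tl _ (gmul_dom g)).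
have lT h : linear (counitT h : C -> k^o) by apply: counit_linear_scalar.
rewrite (linear_slicer _ _ (lT _)) (linear_slicel _ _ (lT _)).
by apply: (@eq_tlift k C C k^o) => x y; apply: mulrC.
Qed.

(** Slicing by eps P_g instead of eps T_(g^-1) gives the form that a partial action requires. *)
Lemma rep_projr g c :
  rep_proj g c = T (gran g) (slicer (fun c => counit (rep_proj g c)) c).
Proof.
rewrite -(ginvK g) rep_projVr gran_ginv; congr (T _ _).
by apply: eq_slicer => y; rewrite counit_rep_proj.
Qed.

Lemma rep_projl g c :
  rep_proj g c = T (gran g) (slicel (fun c => counit (rep_proj g c)) c).
Proof.
rewrite -(ginvK g) rep_projVl gran_ginv; congr (T _ _).
by apply: eq_slicel => y; rewrite counit_rep_proj.
Qed.

Lemma rep_identity e c : identities G e -> T e (T e c) = T e c.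
Proof. by move=> /identity_gran re; rewrite -{1}re rep_ran. Qed.

Lemma rep_proj_identity e c : identities G e -> rep_proj e c = T e c.
Proof. by move=> ide; rewrite rep_projE (ginv_identity ide) rep_identity. Qed.

Lemma rep_proj_ran g c : rep_proj g (T (gran g) c) = rep_proj g c.
Proof. by rewrite !rep_projE -gdom_ginv rep_dom. Qed.

(** This is T_g T_(g^-1) T_g = T_g; it makes T_g and T_(g^-1) mutually inverse between the ranges of
    P_(g^-1) and P_g. *)
Lemma repKV g c : T g (rep_proj (ginv g) c) = T g c.
Proof. by rewrite rep_projVr rep_dom slicer_counit. Qed.

Lemma rep_projK g c : rep_proj g (T g c) = T g c.
Proof. by rewrite rep_projE -rep_projVE repKV. Qed.

Lemma rep_proj_idem g c : rep_proj g (rep_proj g c) = rep_proj g c.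
Proof. by rewrite [rep_proj g c]rep_projE rep_projK. Qed.

Lemma rep_proj_comul g c :
  tmap (rep_proj g) (rep_proj g) (comul c) = comul (rep_proj g c).
Proof.
rewrite rep_projE !TD tmap_comp //; exact: linearP.
Qed.

Lemma rep_projC g h c : rep_proj g (rep_proj h c) = rep_proj h (rep_proj g c).
Proof.
case: (pselect (gran g = gran h)) => [gh|ne]; last first.
  (* If r(g) and r(h) differ, then T_(g^-1) T_h = 0 = T_(h^-1) T_g. *)
  rewrite !rep_projE [T (ginv g) _]T0 ?[T (ginv h) _]T0 ?linear0 // gdom_ginv //.
  exact: nesym.
(* With P_h as a right slice and P_g as a left slice, the inner T_(r(g)) is absorbed and what
   remains is T_(r(g)) of two commuting slices. *)
rewrite [in LHS](rep_projr h) -gh rep_proj_ran (rep_projl g (slicer _ _)).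
rewrite [in RHS](rep_projl g) gh rep_proj_ran (rep_projr h (slicel _ _)).
by congr (T _ _); rewrite slicelC //; apply: counit_linear_scalar.
Qed.

(** T_x absorbs the factor T_(d(h)) of P_(h^-1) because d(x) = d(h). *)
Lemma rep_gmul g h x c : gmul g h = Some x ->
  T g (T h c) = T x (rep_proj (ginv h) c).
Proof.
by move=> ghx; rewrite rep_projVr -(gdom_gmul ghx) rep_dom (Tr _ ghx).
Qed.

Lemma rep_partial_action : partial_action (fun g => range (rep_proj g)) T.
Proof.
have fixP g c : range (rep_proj g) c -> rep_proj g c = c.
  by case=> y _ <-; rewrite rep_proj_idem.
split=> [g|g|].
- split; first split=> [|a u v].
  + by apply: (@mem_set C (range (rep_proj g))); exists 0; rewrite ?linear0.
  + move=> /(@set_mem C (range (rep_proj g)))[y _ <-].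
    move=> /(@set_mem C (range (rep_proj g)))[z _ <-].
    by apply: (@mem_set C (range (rep_proj g))); exists (a *: y + z); rewrite ?linearP.
  + move=> c /fixP <-; rewrite -rep_proj_comul.
    case: (tensor_ind_sum (comul c)) => s ->.
    exists [seq (rep_proj g (p.1 *: p.2.1), rep_proj g p.2.2) | p <- s]; split.
      by move=> p /mapP[q _ ->] /=; split; [exists (q.1 *: q.2.1) | exists q.2.2].
    have lP : linear (rep_proj g) by exact: linearP.
    pose F : {linear (C ⊗ C)%type -> (C ⊗ C)%type} := HB.pack (tmap (rep_proj g) (rep_proj g))
      (GRing.isLinear.Build _ _ _ _ (tmap (rep_proj g) (rep_proj g)) (tmap_linear lP lP)).
    rewrite big_map -[LHS]/(F _) linear_sum; apply: eq_bigr => -[a [y z]] _.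
    rewrite -[RHS]/(rep_proj g (a *: y) ⊗ rep_proj g z).
    rewrite (linear_atZ a y lP) (linear_atZ a _ (tens_linear_l _)) -(tmapE lP lP).
    exact: linear_atZ (tmap_linear lP lP).
(* On the range of P_(g^-1), eps T_g = eps P_(g^-1) = eps. *)
- split=> [|c _|c Dc]; last by rewrite -counit_rep_proj fixP.
    split=> [c _ | c c' /set_mem /fixP <- /set_mem /fixP <- e | c /fixP <-].
    + by exists (T g c); rewrite ?rep_projK.
    + by rewrite !rep_projVE -[T g c]repKV e repKV.
    + by exists (T (ginv g) c); rewrite //; exists (T (ginv g) c) => //; rewrite rep_projK.
  exact: TD.
exists rep_proj; split=> [g|e c ide|g h c|g h x c ghx|g h x c ghx].
- split=> [|c|c|c]; first by split=> // c; apply: rep_proj_idem.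
  + exact: rep_proj_comul.
  + rewrite {1}rep_projr (linear_slicer _ _ (linearP _)).
    by apply: eq_tlift => y z; rewrite (rep_proj_identity _ (identities_gran g)).
  + rewrite {1}rep_projl (linear_slicel _ _ (linearP _)).
    by apply: eq_tlift => y z; rewrite (rep_proj_identity _ (identities_gran g)).
- by move=> /fixP; rewrite rep_proj_identity.
- exact: rep_projC.
- have KP c' : T (ginv h) (rep_proj h c') = T (ginv h) c'.
    by rewrite -[RHS]repKV ginvK.
  (* As x h^-1 = g and x^-1 g = h^-1, P_(x^-1) T_(h^-1) = T_(x^-1) T_x T_(h^-1) = T_(x^-1) T_g P_h =
     T_(h^-1) P_(g^-1) P_h. *)
  rewrite !KP (rep_projVE x) (rep_gmul _ (gmulK ghx)) ginvK.
  by rewrite (rep_gmul _ (gmul_ginv_mull ghx)) rep_projC KP.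
- by rewrite (rep_gmul _ ghx) (rep_projC (ginv h)) rep_proj_idem.
Qed.

Lemma rep_direct_sum : direct_sum_identities (fun g => range (rep_proj g)).
Proof.
have ids_in e : e \in fset_set (identities G) -> identities G e.
  by rewrite in_fset_set // => /set_mem.
(* The component at an identity e is T_e c = P_e c; the value 0 elsewhere is the one
   [direct_sum_identities] prescribes. *)
move=> c; exists (fun g => if `[< identities G g >] then T g c else 0); split.
  split=> [e ide|g /asboolPn/negbTE -> //|].
    by rewrite asboolT //; exists c; rewrite ?rep_proj_identity.
  rewrite fsbig_finite // -[LHS]T1; apply: eq_big_seq => e /ids_in ide.
  by rewrite asboolT.
move=> x [xD x0 ->]; apply: funext => g; case: asboolP => [ig|/x0 -> //].
(* Applying T_g isolates the component at g: T_g T_e = 0 for distinct identities, and T_g fixes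
   C_g. *)
rewrite fsbig_finite // linear_sum -[RHS](sum_identities fG x ig).
apply: eq_big_seq => e /ids_in ie; have [y _ <-] := xD e ie.
rewrite rep_proj_identity //; case: eqP => [->|ne]; first exact: rep_identity.
by rewrite T0 // (identity_gdom ig) (identity_gran ie); apply: nesym.
Qed.

End RepToAction.

(** * From a partial action to a symmetric partial module coalgebra *)

Section ActionToRep.
Context {k : fieldType} {G : groupoidType} (fG : finite_set (identities G)).
Context {C : coalgType k} (D : G -> set C) (theta P : G -> {linear C -> C}).
Implicit Types (g h x e : G) (c : C).
Hypothesis iso : forall g, coalgebra_iso (D (ginv g)) (D g) (theta g).
Hypothesis projP : forall g, linear_projection (D g) (P g).
Hypothesis P_comul : forall g c, tmap (P g) (P g) (comul c) = comul (P g c).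
Hypothesis P_sweedlerr : forall g c, P g c =
  \sweedler_(c1, c2 <- c) (counit (P g c2) *: P (gran g) c1).
Hypothesis P_sweedlerl : forall g c, P g c =
  \sweedler_(c1, c2 <- c) (counit (P g c1) *: P (gran g) c2).
Hypothesis theta_id : forall e c, identities G e -> D e c -> theta e c = c.
Hypothesis PC : forall g h c, P g (P h c) = P h (P g c).
Hypothesis theta_proj : forall g h x c, gmul g h = Some x ->
  theta (ginv h) (P h (P (ginv g) c)) = P (ginv x) (theta (ginv h) (P h c)).
Hypothesis theta_gmul : forall g h x c, gmul g h = Some x ->
  theta g (theta h (P (ginv x) (P (ginv h) c))) =
  theta x (P (ginv x) (P (ginv h) c)).
Hypothesis dsum : direct_sum_identities D.

Lemma proj_in g c : D g (P g c).
Proof. by have [_ <-] := projP g; exists c. Qed.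

Lemma proj_idem g c : P g (P g c) = P g c.
Proof. by have [-> _] := projP g. Qed.

Lemma proj_id g c : D g c -> P g c = c.
Proof. by have [_ <-] := projP g => -[y _ <-]; rewrite proj_idem. Qed.

Lemma proj_slicer g c :
  P g c = P (gran g) (slicer (fun c => counit (P g c)) c).
Proof. by rewrite (linear_slicer _ _ (linearP _)). Qed.

Lemma proj_slicel g c :
  P g c = P (gran g) (slicel (fun c => counit (P g c)) c).
Proof. by rewrite (linear_slicel _ _ (linearP _)). Qed.

(** P_g takes values in the range of the idempotent P_(r(g)), with which it commutes. *)
Lemma proj_ran g c : P g (P (gran g) c) = P g c.
Proof. by rewrite PC (proj_slicer g c) proj_idem. Qed.

(** P_e P_f c = P_f P_e c lies in both C_e and C_f, so directness forces it to vanish. *)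
Lemma proj_orthogonal e f c : identities G e -> identities G f -> e <> f ->
  P e (P f c) = 0.
Proof.
move=> ie jf /eqP ef; set y := P e _.
have De : D e y by apply: proj_in.
have Df : D f y by rewrite /y PC; apply: proj_in.
(* The family with y at g and 0 elsewhere decomposes y; g = e and g = f give two decompositions,
   with values y and 0 at e. *)
have single g : identities G g -> D g y ->
    [/\ forall h, identities G h -> D h (if h == g then y else 0),
        forall h, ~ identities G h -> (if h == g then y else 0) = 0
      & y = \sum_(h \in identities G) (if h == g then y else 0)].
  move=> ig Dg; split=> [h _|h|]; first case: eqP => [-> //|_].
  - by rewrite -(linear0 (P h)); apply: proj_in.
  - by case: eqP => // ->.
  - by rewrite fsbig_finite // (sum_identities fG (fun=> y)).
have [z [_ z_uniq]] := dsum y.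
have := z_uniq _ (single e ie De); rewrite (z_uniq _ (single f jf Df)).
by move=> /(congr1 (@^~ e)) /=; rewrite eqxx (negbTE ef).
Qed.

(** P_e isolates the component in C_e of the decomposition of c, so the sum rebuilds that
    decomposition. *)
Lemma sum_proj c : \sum_(e <- fset_set (identities G)) P e c = c.
Proof.
have ids_in e : e \in fset_set (identities G) -> identities G e.
  by rewrite in_fset_set // => /set_mem.
have [x [[xD _ xc] _]] := dsum c; rewrite {2}xc fsbig_finite //.
apply: eq_big_seq => e /ids_in ie; rewrite xc fsbig_finite // linear_sum.
rewrite -(sum_identities fG x ie); apply: eq_big_seq => f /ids_in jf.
rewrite -(proj_id (xD f jf)); case: eqP => [->|ne]; first exact: proj_idem.
by apply: proj_orthogonal => //; apply: nesym.
Qed.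

Definition action_rep g : {linear C -> C} := theta g \o P (ginv g).

Lemma action_repE g c : action_rep g c = theta g (P (ginv g) c). Proof. by []. Qed.

Lemma action_rep_in g c : D g (action_rep g c).
Proof. by have [[th _ _] _ _] := iso g; apply: th; apply: proj_in. Qed.

Lemma counit_action_rep g c : counit (action_rep g c) = counit (P (ginv g) c).
Proof. by have [_ _ ->] := iso g; last exact: proj_in. Qed.

(** The first compatibility axiom, taken for x h^-1 = g, moves P_(g^-1) across theta_h, where it
    becomes P_(x^-1); the second then merges theta_g theta_h. *)
Lemma action_rep_gmul g h x c : gmul g h = Some x ->
  action_rep g (action_rep h c) = theta x (P (ginv x) (P (ginv h) c)).
Proof.
move=> ghx; rewrite !action_repE; have := theta_proj c (gmulK ghx).
by rewrite ginvK => <-; rewrite PC theta_gmul.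
Qed.

Lemma proj_ginv_gdom g h x c : gmul g h = Some x ->
  P (ginv x) (P (gran (ginv h)) c) = P (ginv x) c.
Proof. by move=> ghx; rewrite gran_ginv -(gdom_gmul ghx) -gran_ginv proj_ran. Qed.

Lemma action_symmetric_partial_rep : symmetric_partial_rep action_rep.
Proof.
split=> [c|g c|g h x c ghx|g h x c ghx|g h c gh].
- rewrite -[RHS]sum_proj; apply: eq_big_seq => e.
  rewrite in_fset_set // => /set_mem ie.
  by rewrite action_repE (ginv_identity ie) theta_id //; apply: proj_in.
- have [_ thD _] := iso g.
  rewrite action_repE thD; last exact: proj_in.
  by rewrite -P_comul tmap_comp //; apply: linearP.
(* P_(h^-1) c is P_(r(h^-1)) of a slice of c, and P_(x^-1) absorbs P_(r(h^-1)) since r(h^-1) =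
   r(x^-1). *)
- rewrite (action_rep_gmul _ ghx) (proj_slicer (ginv h)) (proj_ginv_gdom _ ghx) action_repE.
  by do 2 congr (_ _ _); apply: eq_slicer => y; rewrite counit_action_rep.
- rewrite (action_rep_gmul _ ghx) (proj_slicel (ginv h)) (proj_ginv_gdom _ ghx) action_repE.
  by do 2 congr (_ _ _); apply: eq_slicel => y; rewrite counit_action_rep.
(* P_(g^-1) factors through P_(d(g)) and P_h through P_(r(h)); these are orthogonal because gh is
   undefined. *)
rewrite action_repE -(proj_id (action_rep_in h c)) -[P h _]proj_ran PC.
rewrite -(proj_ran (ginv g)) gran_ginv (@proj_orthogonal (gdom g) (gran h)) ?linear0 //.
- exact: identities_gdom.
- exact: identities_gran.
- by move=> /gmul_defined; rewrite gh.
Qed.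

End ActionToRep.

Theorem mainTheorem1 (k : fieldType) (G : groupoidType)
    (fG : finite_set (identities G)) (C : coalgType k) :
  (exists (D : G -> set C) (theta : G -> {linear C -> C}),
     partial_action D theta /\ direct_sum_identities D) <->
  (exists act : {linear (groupoid_algebra k fG ⊗ C)%type -> C},
     symmetric_partial_module_coalgebra act).
Proof.
split=> [[D [theta [[_ iso [P [projP theta_id PC theta_proj theta_gmul]]] dsum]]]|].
  apply: (@symmetric_partial_rep_act _ _ _ _ (action_rep theta P)).
  by apply: (action_symmetric_partial_rep fG iso) => // g; case: (projP g).
case=> act /symmetric_partial_module_coalgebraE repT.
exists (fun g => range (rep_proj (fun g => act_at act (delta k fG g)) g)).
exists (fun g => act_at act (delta k fG g)).
by split; [apply: rep_partial_action repT | apply: rep_direct_sum repT].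
Qed.
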